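(* Let $F$ be a fixed nonempty graph (i.e. with at least one edge), and let $r\ge 2$ be a fixed integer. Let $\theta^*=\theta^*(F,r)$ be the unique solution of $\Lambda_{r,\theta}(F)=0$ (as an equation in $\theta\in[0,2]$). Then for all $p=p(n)\ll n^{-\theta^*}$ there exists a strategy with which the player a.a.s. wins the vertex balanced Ramsey game with parameters $F$ and $r$.
   Context: All asymptotics are for $n\to\infty$; $f\ll g$ means $f=o(g)$; a.a.s. means with probability tending to $1$ as $n\to\infty$. Vertex balanced Ramsey game with parameters $F$ and $r$: assume $r$ divides $n$. At the start a binomial random graph $G(n,p)$ on vertex set $\{v_1,\dots,v_n\}$ is generated, hidden from the player. In step $i$ ($1\le i\le n/r$) the vertices $v_{(i-1)r+1},\dots,v_{ir}$ are revealed, so that the player sees exactly the graph induced by $v_1,\dots,v_{ir}$, and she must immediately assign each of $r$ available colors to exactly one of the $r$ new vertices. She wins if all $n$ vertices are colored without creating a (vertex-)monochromatic copy of $F$ (copy = not necessarily induced subgraph isomorphic to $F$). Ordered graphs: an ordered graph $(H,\pi)$ is a graph $H$ with $h=v(H)$ vertices together with an ordering $\pi=(u_1,\dots,u_h)$ of its vertices. $\Pi(V(F))$ is the set of all orderings of $V(F)$. For a subgraph $J\subseteq H$ (not necessarily induced), $\pi|_J$ is the ordering of $V(J)$ induced by $\pi$. $H\setminus u_1$ is $H$ with $u_1$ and its incident edges removed, and $\pi\setminus u_1:=\pi|_{H\setminus u_1}$. For $r\ge2$ and real $0\le\theta\le2$ define recursively: $\lambda_{r,\theta}(H,\pi):=0$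 if $v(H)=0$, and otherwise, with $\pi=(u_1,\dots,u_h)$, $$\lambda_{r,\theta}(H,\pi):=1+\bigl(\lambda_{r,\theta}(H\setminus u_1,\pi\setminus u_1)-\theta\deg_H(u_1)\bigr)+(r-1)\min_{J\subseteq H,\ u_1\in V(J)}\bigl(\lambda_{r,\theta}(J\setminus u_1,\pi|_{J\setminus u_1})-\theta\deg_J(u_1)\bigr).$$ Further $$\Lambda_{r,\theta}(F):=\max_{\pi\in\Pi(V(F))}\ \min_{H\subseteq F}\lambda_{r,\theta}(H,\pi|_H),$$ where $H$ ranges over all subgraphs of $F$ with at least one vertex. As a function of $\theta$, $\Lambda_{r,\theta}(F)$ is continuous, piecewise linear, non-increasing and has a unique root. *)

(* Defs.v *)
From HB Require Import structures.
From mathcomp Require Import all_boot all_order all_algebra all_fingroup.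
From mathcomp Require Import all_classical all_reals all_analysis.
Set Implicit Arguments.
Unset Strict Implicit.
Unset Printing Implicit Defensive.
Import Order.TTheory GRing.Theory Num.Theory numFieldNormedType.Exports.
Local Open Scope ring_scope.

Section Graphs.
Variable T : finType.

Definition is_simple (VE : {set T} * {set {set T}}) : bool :=
  [forall e in VE.2, (#|e| == 2) && (e \subset VE.1)].

(* A finite simple graph whose vertex set is a subset of [T]; edges are the
   two-element sets of their endpoints. *)
Record graph := Graph { graph_val : {set T} * {set {set T}};
                        graph_valP : is_simple graph_val }.

HB.instance Definition _ := [isSub for graph_val].
HB.instance Definition _ := [Finite of graph by <:].

Definition verts (G : graph) : {set T} := (val G).1.
Definition edges (G : graph) : {set {set T}} := (val G).2.

Definition deg (G : graph) (u : T) : nat := #|[set e in edges G | u \in e]|.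

Definition subgraph (J H : graph) : bool :=
  (verts J \subset verts H) && (edges J \subset edges H).

Lemma induced_subproof (G : graph) (S : {set T}) :
  is_simple (verts G :&: S, [set e in edges G | e \subset S]).
Proof.
apply/forall_inP => e /=; rewrite inE => /andP[eG eS].
by have /forall_inP/(_ e eG)/andP[-> eV] := graph_valP G; rewrite finset.subsetI eV eS.
Qed.

Definition induced (G : graph) (S : {set T}) : graph :=
  Graph (induced_subproof G S).

Definition delv (G : graph) (u : T) : graph := induced G [set~ u].

End Graphs.

Section LambdaDef.
Variables (R : realType) (T : finType) (r : nat) (theta : R).

(* [lambda s H] is lambda_{r,theta}(H, s|_H): the list [s] may contain vertices
   outside [H], which are skipped, so that restricting an ordering to a
   subgraph is implicit (see [lambda_restrict] and [lambda_cons]).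
   The neutral element of the minimum is its term for J = H. *)
Fixpoint lambda (s : seq T) (H : graph T) : R :=
  if s is u :: s' then
    if u \in verts H then
      1 + (lambda s' (delv H u) - theta * (deg H u)%:R)
        + (r%:R - 1) *
          \big[Num.min/lambda s' (delv H u) - theta * (deg H u)%:R]_(
              J : graph T | subgraph J H && (u \in verts J))
            (lambda s' (delv J u) - theta * (deg J u)%:R)
    else lambda s' H
  else 0.

Lemma lambda_restrict_sub (A : {set T}) (s : seq T) (H : graph T) :
  verts H \subset A -> lambda [seq x <- s | x \in A] H = lambda s H.
Proof.
elim: s H => //= u s IHs H HA.
have delA (J : graph T) : subgraph J H -> verts (delv J u) \subset A.
  move=> /andP[JH _]; apply: fintype.subset_trans HA.
  exact: fintype.subset_trans (subsetIl _ _) JH.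
have HH : subgraph H H by rewrite /subgraph !subxx.
case: ifP => uA /=; last first.
  case: ifP => [uH|_]; last exact: IHs.
  by move/fintype.subsetP/(_ u uH): HA; rewrite uA.
rewrite !IHs //; last exact: delA.
case: ifP => // uH; congr (_ + _ * _).
by apply: eq_bigr => J /andP[JH _]; rewrite IHs // delA.
Qed.

Lemma lambda_restrict (s : seq T) (H : graph T) :
  lambda [seq x <- s | x \in verts H] H = lambda s H.
Proof. exact: lambda_restrict_sub. Qed.

Lemma lambda_cons (u : T) (s : seq T) (H : graph T) : u \in verts H ->
  lambda (u :: s) H =
    1 + (lambda [seq x <- s | x \in verts (delv H u)] (delv H u)
         - theta * (deg H u)%:R)
      + (r%:R - 1) *
        \big[Num.min/lambda s (delv H u) - theta * (deg H u)%:R]_(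
            J : graph T | subgraph J H && (u \in verts J))
          (lambda [seq x <- s | x \in verts (delv J u)] (delv J u)
           - theta * (deg J u)%:R).
Proof.
move=> uH; rewrite /= uH lambda_restrict; congr (_ + _ * _).
by apply: eq_bigr => J _; rewrite lambda_restrict.
Qed.

(* The neutral elements below are the terms H = F and s = enum (verts F), so
   they do not affect the minimum (for [F] with a vertex) and the maximum. *)
Definition min_lambda (F : graph T) (s : seq T) : R :=
  \big[Num.min/lambda s F]_(H : graph T | subgraph H F && (verts H != finset.set0))
    lambda s H.

Definition Lambda (F : graph T) : R :=
  \big[Num.max/min_lambda F (enum (verts F))]_(s <- permutations (enum (verts F)))
    min_lambda F s.

End LambdaDef.

Section Game.
Variables n r : nat.

(* The vertices v_1, ..., v_n are the elements of 'I_n, with steps and vertices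
   numbered from 0: step [i] reveals the [r] vertices [v] with [v %/ r = i]. *)
Definition coloring := {ffun 'I_n -> option 'I_r}.

(* In step [i] the player is given the graph revealed so far and the colors
   assigned in earlier steps; the permutation [s] she answers with gives color
   [s j] to the vertex numbered [i * r + j]. *)
Definition strategy := nat -> graph 'I_n -> coloring -> {perm 'I_r}.

Definition visible (G : graph 'I_n) (i : nat) : graph 'I_n :=
  induced G [set v : 'I_n | (v < i.+1 * r)%N].

Fixpoint play (sigma : strategy) (G : graph 'I_n) (i : nat) : coloring :=
  if i is i'.+1 then
    let c := play sigma G i' in
    let s := sigma i' (visible G i') c in
    [ffun v : 'I_n => if (v %/ r)%N == i'
                      then omap s (insub (v %% r)%N) else c v]
  else [ffun=> None].

End Game.

Definition isomorphic (T U : finType) (F : graph T) (H : graph U) : bool :=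
  [exists f : {ffun T -> U},
    [&& [forall x in verts F, forall y in verts F, (f x == f y) ==> (x == y)],
        verts H == [set f x | x in verts F]
      & edges H == [set f @: e | e : {set T} in edges F]]].

Definition monochromatic_copy (T : finType) (F : graph T) n r
    (G : graph 'I_n) (c : coloring n r) : bool :=
  [exists H : graph 'I_n,
    [&& subgraph H G, isomorphic F H
      & [exists k : 'I_r, forall v in verts H, c v == Some k]]].

(* For [r %| n] every vertex is colored after [n %/ r] steps; as vertices keep
   their colors, no monochromatic copy was created iff none is present then. *)
Definition wins (T : finType) (F : graph T) n r (sigma : strategy n r)
    (G : graph 'I_n) : bool :=
  ~~ monochromatic_copy F G (play sigma G (n %/ r)%N).

(* The probability that the binomial random graph G(n, p) satisfies [A]. *)
Definition gnp_pr (R : realType) n (p : R) (A : pred (graph 'I_n)) : R :=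
  \sum_(G : graph 'I_n | (verts G == [set: 'I_n]%SET) && A G)
    p ^+ #|edges G| * (1 - p) ^+ ('C(n, 2) - #|edges G|).

(* Main.v *)
Require Import Defs.
From HB Require Import structures.
From mathcomp Require Import all_boot all_order all_algebra all_fingroup.
From mathcomp Require Import reals exp.
Set Implicit Arguments.
Unset Strict Implicit.
Unset Printing Implicit Defensive.
Import Order.TTheory GRing.Theory Num.Theory.
Local Open Scope ring_scope.

(* The player ranks the ordered graphs (J, pi) by their threat
   lambda(J \ u_1) - theta deg(u_1), the smallest being the most dangerous, and
   answers so that no exchange of the colors of two new vertices improves the
   worse of the two.  Hence, whenever v receives color k and thereby completes H,
   there are r - 1 further pairs of a new vertex and a color, in the row or column
   of (v, k), each of which would complete a graph at least as dangerous as every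
   J contained in H with youngest vertex u_1.  Unfolding this for all vertices of
   H yields a history: a set S of steps and a set E of edges between their
   vertices with |S| - theta |E| <= lambda(H), since |S| - theta |E| is modular
   and overlaps of two histories have nonnegative cost.  Histories have bounded
   size: each rival of strictly smaller threat saves a fixed delta > 0 in this
   inequality, which can happen only boundedly often, and a rival of equal threat
   is no larger than J.  A monochromatic copy of F has an ordering pi, and some H
   in F satisfies lambda(H, pi) <= 0; its history is then a nonempty pair (S, E)
   of bounded size with |S| <= theta |E|, and the expected number of such pairs
   in G(n, p) is o(1). *)

(** * Locally optimal assignments of colors and rival positions *)

Section Assignment.
Variable r : nat.
Implicit Types (b : 'I_r -> 'I_r -> nat) (s : {perm 'I_r}) (i j : 'I_r).

Definition assignment b : {perm 'I_r} :=
  [arg min_(s < (1%g : {perm 'I_r}) | xpredT s) (\sum_(j : 'I_r) 2 ^ b j (s j))]%N.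

(* Exchanging the answers [s i] and [s j] replaces [2 ^ x + 2 ^ y] by a sum that
   is smaller as soon as both new exponents are below [x]. *)
Lemma assignmentP b i j : let s := assignment b in
  (b i (s i) <= b i (s j))%N || (b i (s i) <= b j (s i))%N.
Proof.
rewrite /assignment; case: arg_minnP => //= s _ /(_ (tperm i j * s)%g isT).
have [->|ij] := eqVneq i j; first by rewrite leqnn.
rewrite (bigD1 i) // (bigD1 j) 1?eq_sym //= [X in (_ <= X)%N](bigD1 i) //.
rewrite [X in (_ <= _ + X)%N](bigD1 j) 1?eq_sym //=.
under [X in (_ <= _ + (_ + X))%N]eq_bigr => x /andP[xi xj].
  rewrite permM tpermD 1?eq_sym //; over.
rewrite /= !permM tpermL tpermR !addnA leq_add2r.
case: (leqP (b i (s i)) (b i (s j))) => //= lt1.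
apply: contraLR; rewrite -!ltnNge => lt2.
have := leq_add (leq_pexp2l (isT : (0 < 2)%N) lt1) (leq_pexp2l (isT : (0 < 2)%N) lt2).
rewrite !expnS -mulnDr addnn -mul2n leq_pmul2l // => /leq_ltn_trans; apply.
by rewrite -[X in (X < _)%N]addn0 ltn_add2l expn_gt0.
Qed.

(* As [j] varies, these are [r] distinct pairs at least as bad as the chosen
   pair [(i, s i)]. *)
Definition rival b i j : 'I_r * 'I_r := let s := assignment b in
  if (b i (s i) <= b i (s j))%N then (i, s j) else (j, s i).

Lemma rival_id b i : rival b i i = (i, assignment b i).
Proof. by rewrite /rival leqnn. Qed.

Lemma leq_rival b i j :
  (b i (assignment b i) <= b (rival b i j).1 (rival b i j).2)%N.
Proof. by have := assignmentP b i j; rewrite /rival; case: ifP. Qed.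

Lemma rival_inj b i : injective (rival b i).
Proof.
have swap j k : (i, assignment b j) = (k, assignment b i) -> j = k.
  by case=> <- /perm_inj.
move=> j k; rewrite /rival; case: ifP => _; case: ifP => _.
- by case=> /perm_inj.
- exact: swap.
- by move=> /esym/swap.
- by case.
Qed.

End Assignment.

(** * The union bound in the binomial random graph *)

Section Gnp.
Variables (R : realType) (n : nat).
Implicit Types (p : R) (A : pred (graph 'I_n)) (E X : {set {set 'I_n}}).

(** Expand a product of sums [f i + g i], with [f] the weight of taking [i] and [g] that of omitting
    it; a zero weight kills every set not between [E] and [X]. *)
Lemma sum_binomial_between (I : finType) (X E : {set I}) p : E \subset X ->
  \sum_(A : {set I} | (E \subset A) && (A \subset X))
    p ^+ #|A| * (1 - p) ^+ (#|X| - #|A|) = p ^+ #|E|.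
Proof.
move=> EX.
pose f i := if i \in X then p else 0.
pose g i := if i \in X then if i \in E then 0 else 1 - p else 1.
have -> : p ^+ #|E| = \prod_i (f i + g i).
  rewrite (bigID (mem E)) /= [X in _ * X]big1 ?mulr1 => [|i iE].
    rewrite (eq_bigr (fun=> p)) ?prodr_const // => i iE.
    by rewrite /f /g (fintype.subsetP EX) // iE addr0.
  by rewrite /f /g (negPf iE); case: ifP; rewrite ?add0r // addrC subrK.
rewrite bigA_distr big_mkcond /=.
apply: eq_bigr => A _; case: ifP => [/andP[EA AX]|].
  rewrite (bigID (mem A)) /= (eq_bigr (fun=> p)) => [|i iA]; last first.
    by rewrite iA /f (fintype.subsetP AX).
  rewrite prodr_const; congr (_ * _).
  rewrite (bigID (mem X)) /= [X in _ * X]big1 ?mulr1 => [|i /andP[/negPf-> /negPf iX]].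
    rewrite (eq_bigr (fun=> 1 - p)) => [|i /andP[iA iX]].
      rewrite prodr_const -(cardsDS AX); congr (_ ^+ _).
      by apply: eq_card => i; rewrite !inE.
    rewrite (negPf iA) /g iX ifN //; apply: contra iA; exact: (fintype.subsetP EA).
  by rewrite /g iX.
move=> /negbT; rewrite negb_and => /orP[] /fintype.subsetPn[i i1 i2].
  by rewrite (bigD1 i) //= (negPf i2) /g (fintype.subsetP EX) // i1 mul0r.
by rewrite (bigD1 i) //= i1 /f (negPf i2) mul0r.
Qed.

Definition pairs : {set {set 'I_n}} := [set e : {set 'I_n} | #|e| == 2].

Lemma spanning_graph_subproof E : is_simple ([set: 'I_n], E :&: pairs).
Proof.
by apply/forall_inP => e; rewrite !inE => /andP[_ ->]; rewrite subsetT.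
Qed.

(** Cutting down to [pairs] turns every set of sets into a graph, so sums over graphs can be
    reindexed by edge sets. *)
Definition spanning_graph E : graph 'I_n := Graph (spanning_graph_subproof E).

Lemma edges_pairs (G : graph 'I_n) : edges G \subset pairs.
Proof.
apply/fintype.subsetP => e eG; rewrite inE.
by have /forall_inP/(_ e eG)/andP[] := graph_valP G.
Qed.

Lemma gnp_pr_sub p E : E \subset pairs ->
  gnp_pr p (fun G => E \subset edges G) = p ^+ #|E|.
Proof.
move=> Ep; rewrite -(sum_binomial_between p Ep) /gnp_pr.
rewrite (reindex_onto spanning_graph (@edges _)) /= => [|G /andP[/eqP VG _]].
  apply: eq_big => [A|A /andP[_ /eqP AE]]; last first.
    by rewrite AE card_draws card_ord.
  rewrite eqxx /= subsetI Ep andbT; apply: andb_id2l => _.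
    by rewrite /edges /= (sameP eqP finset.setIidPl).
apply: val_inj; rewrite /= (finset.setIidPl (edges_pairs G)).
by rewrite -VG -surjective_pairing.
Qed.

(** Union bound; the total weight is 1 by [gnp_pr_sub] with no prescribed edge. *)
Lemma gnp_pr_union (I : finType) (Q : pred I) (E : I -> {set {set 'I_n}}) A p :
  0 <= p <= 1 -> (forall i, Q i -> E i \subset pairs) ->
  (forall G, verts G = [set: 'I_n]%SET -> ~~ A G ->
     exists2 i, Q i & E i \subset edges G) ->
  1 - \sum_(i | Q i) p ^+ #|E i| <= gnp_pr p A <= 1.
Proof.
move=> /andP[p0 p1] Ep AE.
pose w (G : graph 'I_n) := p ^+ #|edges G| * (1 - p) ^+ ('C(n, 2) - #|edges G|).
have w0 G : 0 <= w G by rewrite mulr_ge0 ?exprn_ge0 // subr_ge0.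
have <- : gnp_pr p A + \sum_(G | (verts G == [set: 'I_n]%SET) && ~~ A G) w G = 1.
  rewrite -(bigID A) /=; transitivity (gnp_pr p (fun G : graph 'I_n => finset.set0 \subset edges G)).
    by apply: eq_bigl => G; rewrite sub0set andbT.
  by rewrite gnp_pr_sub ?sub0set // cards0.
rewrite lerDl sumr_ge0 // andbT lerBlDr lerD2l.
under [X in _ <= X]eq_bigr => i Qi do rewrite -gnp_pr_sub ?Ep // /gnp_pr big_mkcondr.
rewrite exchange_big /= big_mkcondr; apply: ler_sum => G /eqP VG.
case: ifP => AG; last by apply: sumr_ge0 => i _; case: ifP => // _; apply: w0.
have [i Qi EiG] := AE G VG AG.
rewrite (bigD1 i) //= EiG lerDl; apply: sumr_ge0 => j _; case: ifP => // _; exact: w0.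
Qed.

End Gnp.

(** * First moment of cheap pairs of steps and edges *)

Section Witness.
Variables (R : realType) (theta : R) (m r : nat).

Lemma step_subproof (v : 'I_(m * r)) : (v %/ r < m)%N.
Proof. by case: r v => [|r'] v; [case: v => v; rewrite muln0 | rewrite ltn_divLR]. Qed.

Definition step (v : 'I_(m * r)) : 'I_m := Ordinal (step_subproof v).

(** The exponent of n in the expected number of such pairs at p = n^(-theta). Counting steps instead
    of vertices changes only constants. *)
Definition cost (S : {set 'I_m}) (E : {set {set 'I_(m * r)}}) : R :=
  #|S|%:R - theta * #|E|%:R.

Definition supported (S : {set 'I_m}) (E : {set {set 'I_(m * r)}}) : bool :=
  [forall e in E, forall v in e, step v \in S].

Definition cheap (K : nat) (W : {set 'I_m} * {set {set 'I_(m * r)}}) : bool :=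
  [&& W.1 != finset.set0, (#|W.1| <= K)%N, supported W.1 W.2,
      W.2 \subset pairs (m * r) & cost W.1 W.2 <= 0].

Lemma card_step_preimset (S : {set 'I_m}) : (#|step @^-1: S| <= #|S| * r)%N.
Proof.
pose f (v : 'I_(m * r)) := (step v, inord (v %% r) : 'I_r.-1.+1).
case: (posnP r) => [r0|r0].
  apply: leq_trans (_ : 0 <= _)%N => //; rewrite leqn0 cards_eq0 -subset0.
  by apply/fintype.subsetP => -[v vlt]; exfalso; move: vlt; rewrite r0 muln0.
rewrite -(card_in_imset (f := f)) => [|u v _ _ [uv /(congr1 val)]].
  apply: leq_trans (_ : #|setX S [set: 'I_r.-1.+1]| <= _)%N.
    apply: subset_leq_card; apply/fintype.subsetP => _ /imsetP[v vS ->].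
    by rewrite !inE in vS *; rewrite vS.
  by rewrite cardsX cardsT card_ord prednK.
rewrite /= !inordK ?prednK ?ltn_mod // => uvr; apply: ord_inj.
by rewrite (divn_eq u r) (divn_eq v r) uv uvr.
Qed.

(** There are at most [m ^ a] sets of size [a], so each of the [K.+1] sizes contributes at most
    1. *)
Lemma sum_card_le (K : nat) :
  \sum_(S : {set 'I_m} | (#|S| <= K)%N) (m%:R : R) ^- #|S| <= K.+1%:R.
Proof.
rewrite (partition_big (fun S : {set 'I_m} => inord #|S| : 'I_K.+1) predT) //=.
rewrite -[X in _ <= X%:R]card_ord -sumr_const; apply: ler_sum => a _.
rewrite (eq_bigr (fun=> m%:R ^- a)) => [|S /andP[SK /eqP <-]]; last first.
  by rewrite inordK.
rewrite sumr_const -[X in X <= _]mulr_natr.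
(* For [m = 0] the convention that 0 has inverse 0 annihilates the terms with [a > 0]. *)
have [m0|m0] := posnP m.
  move: a; rewrite m0 => a.
  case: (posnP a) => [->|a0].
    rewrite expr0 invr1 mul1r (ler_nat R _ 1).
    apply: leq_trans (max_card _) _; rewrite -cardsT -(powersetT) card_powerset cardsT card_ord //.
  by rewrite expr0n (gtn_eqF a0) invr0 mul0r.
rewrite mulrC ler_pdivrMr ?exprn_gt0 ?ltr0n // mul1r -natrX ler_nat.
apply: leq_trans (_ : #|[set S : {set 'I_m} | #|S| == a]| <= _)%N.
  apply: subset_leq_card; apply/fintype.subsetP => S; rewrite !inE.
  by move=> /andP[SK /eqP <-]; rewrite inordK.
rewrite card_draws card_ord -(leq_pmul2r (fact_gt0 a)) bin_ffact.
apply: leq_trans (leq_pmulr _ (fact_gt0 a)).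
elim: (nat_of_ord a) => // b IH; rewrite ffactnSr expnSr; apply: leq_mul IH (leq_subr _ _).
Qed.

(** Cheapness gives p^|E| <= eps n^(-theta |E|) <= eps m^(-|S|), and at most [K] steps carry at most
    [2 ^ 2 ^ (K * r)] edge sets. *)
Lemma sum_cheap_le (K : nat) (p eps : R) : (0 < r)%N ->
  0 <= p -> 0 <= eps <= 1 -> p <= eps * (m * r)%:R `^ (- theta) ->
  \sum_(W | cheap K W) p ^+ #|W.2| <= eps * (K.+1 * 2 ^ 2 ^ (K * r))%:R.
Proof.
move=> r0 p0 /andP[e0 e1] pe.
pose F (S : {set 'I_m}) := powerset (powerset (step @^-1: S)).
pose Q (W : {set 'I_m} * {set {set 'I_(m * r)}}) :=
  (#|W.1| <= K)%N && (W.2 \in F W.1).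
have cheapQ W : cheap K W -> Q W.
  case/and5P => _ WK /forall_inP sW _ _; rewrite /Q WK /F inE.
  apply/fintype.subsetP => e eW; rewrite inE; apply/fintype.subsetP => v ve.
  by rewrite inE; have /forall_inP := sW e eW; apply.
have bound W : cheap K W -> p ^+ #|W.2| <= eps * m%:R ^- #|W.1|.
  case/and5P => W0 _ _ _; rewrite /cost subr_le0 => SE.
  have S0 : (0 < #|W.1|)%N by rewrite card_gt0.
  have m0 : (0 < m)%N by case/card_gt0P: S0 => x _; case: m x => // -[].
  (* A nonempty set of steps with cost at most 0 forces an edge, which keeps one factor [eps]. *)
  have E0 : (0 < #|W.2|)%N.
    rewrite lt0n; apply/eqP => E0; move: SE; rewrite E0 mulr0 leNgt ltr0n.
    by rewrite S0.
  have n1 : 1 <= (m * r)%:R :> R by rewrite ler1n muln_gt0 m0.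
  apply: le_trans (lerXn2r _ _ _ pe) _; rewrite ?nnegrE ?mulr_ge0 ?powR_ge0 //.
  rewrite exprMn; apply: ler_pM; rewrite ?exprn_ge0 ?powR_ge0 //.
    by rewrite -[X in _ <= X]expr1; apply: ler_wiXn2l.
  rewrite -powR_mulrn ?powR_ge0 // -powRrM.
  apply: (@le_trans _ _ ((m * r)%:R `^ (- #|W.1|%:R))).
    by apply: ler_powR => //; rewrite mulNr lerN2.
  rewrite powR_invn ?ler0n // lef_pV2 ?posrE ?exprn_gt0 ?ltr0n ?muln_gt0 ?m0 //.
  by apply: lerXn2r; rewrite ?nnegrE ?ler0n // ler_nat leq_pmulr.
apply: le_trans (_ : \sum_(W | Q W) eps * m%:R ^- #|W.1| <= _).
  rewrite big_mkcond [X in _ <= X]big_mkcond; apply: ler_sum => W _.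
  case: ifP => [cW|_]; first by rewrite (cheapQ _ cW) bound.
  by case: ifP => // _; rewrite mulr_ge0 // invr_ge0 exprn_ge0 // ler0n.
rewrite -mulr_sumr ler_wpM2l //.
rewrite -(pair_big_dep (fun S : {set 'I_m} => (#|S| <= K)%N) (fun S E => E \in F S)
   (fun S _ => m%:R ^- #|S|)) /=.
rewrite natrM; apply: le_trans (ler_wpM2r _ (sum_card_le K)); rewrite ?ler0n // mulr_suml.
apply: ler_sum => S SK; rewrite sumr_const -[X in X <= _]mulr_natr ler_wpM2l //.
  by rewrite invr_ge0 exprn_ge0 // ler0n.
rewrite ler_nat /F card_powerset card_powerset !leq_exp2l //.
exact: leq_trans (card_step_preimset S) (leq_mul SK (leqnn r)).
Qed.

End Witness.

(** * Deleting a vertex *)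

Section Graphs.
Variable T : finType.
Implicit Types (J H : graph T) (e : {set T}) (u x : T).

Lemma subgraph_refl H : subgraph H H.
Proof. by rewrite /subgraph !subxx. Qed.

Lemma edge_incident H u e : e \in edges H -> u \in e ->
  exists2 x, e = [set u; x] & x \in verts (delv H u).
Proof.
move=> eH ue; have /forall_inP/(_ e eH)/andP[/cards2P[x [y [xy eE]]] eV] := graph_valP H.
have ex z : z \in e -> z != u -> z \in verts (delv H u).
  move=> ze zu; rewrite /verts /= !inE zu andbT.
  exact: (fintype.subsetP eV).
move: ue ex; rewrite eE !inE => /orP[] /eqP-> ex.
  by exists y => //; apply: ex; rewrite ?inE ?eqxx ?orbT // eq_sym.
by exists x; [rewrite finset.setUC|apply: ex; rewrite ?inE ?eqxx].
Qed.

Lemma card_verts_delv H u : u \in verts H -> #|verts (delv H u)| = #|verts H|.-1.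
Proof.
move=> uH; rewrite [in RHS](cardsD1 u) uH /=; apply: eq_card => x.
by rewrite /verts /= !inE andbC.
Qed.

End Graphs.

(** * The strategy: ranking patterns by threat *)

Section Player.
Variables (R : realType) (T : finType) (r : nat) (theta : R).
Implicit Types (H J : graph T) (u : T) (s : seq T).

(* The exponent of the number of ways in which a given vertex, playing the role
   of the youngest vertex [u], completes a copy of [J]. *)
Definition threat s J u : R := lambda r theta s (delv J u) - theta * (deg J u)%:R.

(** Bounded sequences make the type finite, so patterns can be ranked by counting. *)
Definition pattern : finType := (T * #|T|.-bseq T * graph T)%type.
Implicit Types P Q : pattern.

Definition pthreat P : R := threat P.1.2 P.2 P.1.1.

(* Ties are broken by size: this is what keeps the histories bounded. *)
Definition outranks P Q : bool :=
  (pthreat P < pthreat Q) ||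
  (pthreat P == pthreat Q) && (#|verts P.2| < #|verts Q.2|)%N.

(** Encodes danger as a natural number, as [assignment] needs; more dangerous patterns have larger
    rank. *)
Definition rank P : nat := #|[set Q | outranks P Q]|.

(** If [P] outranked [Q], then by transitivity the set counted by [rank Q] would be a proper subset
    of that counted by [rank P], missing [Q] itself. *)
Lemma leq_rank P Q : (rank P <= rank Q)%N ->
  pthreat Q < pthreat P \/ pthreat Q = pthreat P /\ (#|verts Q.2| <= #|verts P.2|)%N.
Proof.
move=> le_rank; case: (ltgtP (pthreat Q) (pthreat P)) => [|lt_PQ|eq_QP]; [by left| |].
  exfalso; move: le_rank; apply/negP; rewrite -ltnNge; apply: proper_card.
  apply/properP; split.
    apply/fintype.subsetP => Q'; rewrite !inE /outranks => /orP[/(lt_trans lt_PQ)-> //|].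
    by case/andP => /eqP <- _; rewrite lt_PQ.
  by exists Q; rewrite inE /outranks ?lt_PQ // ltxx eqxx ltnn.
right; split => //; rewrite leqNgt; apply/negP => lt_PQ.
move: le_rank; apply/negP; rewrite -ltnNge; apply: proper_card.
apply/properP; split.
  apply/fintype.subsetP => Q'; rewrite !inE /outranks eq_QP => /orP[-> //|].
  by case/andP => -> /(ltn_trans lt_PQ)->; rewrite orbT.
by exists Q; rewrite inE /outranks ?eq_QP ?ltxx ?eqxx ?ltnn ?lt_PQ.
Qed.

Section Board.
Variable n : nat.
Implicit Types (c : coloring n r) (E : {set {set 'I_n}}) (f : {ffun T -> 'I_n}).

(** The ordering [s] is youngest first. Strictly decreasing steps can be demanded since a color
    occurs once per step, and they make [f] injective. [E] is a parameter because copies are viewed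
    both in the visible and in the full graph. *)
Definition mono_copy c E (k : 'I_r) s H f : bool :=
  [&& pairwise (fun x y => (f y %/ r < f x %/ r)%N) [seq x <- s | x \in verts H],
      verts H \subset s,
      [forall x in verts H, c (f x) == Some k]
    & [forall e in edges H, f @: e \in E]].

Lemma mono_copy_inj c E k s H f :
  mono_copy c E k s H f -> {in verts H &, injective f}.
Proof.
case/and4P => f_step Hs _ _ x y xH yH fxy.
set l := [seq x <- s | x \in verts H] in f_step.
have mem z : z \in verts H -> z \in l.
  by move=> zH; rewrite mem_filter zH (fintype.subsetP Hs).
have ltF z w : z \in l -> w \in l -> f z = f w -> (index z l < index w l)%N -> False.
  move=> zl wl fzw /(pairwiseP x f_step).
  by rewrite !inE !index_mem zl wl !nth_index // fzw ltnn => /(_ isT isT).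
rewrite -(nth_index x (mem x xH)) -[RHS](nth_index x (mem y yH)); congr nth.
have [xl yl] := (mem x xH, mem y yH).
by case: (ssrnat.ltngtP (index x l) (index y l)) => // lt_i; [case: (ltF _ _ xl yl fxy lt_i)|case: (ltF _ _ yl xl (esym fxy) lt_i)].
Qed.

Lemma mono_copy_sub c E k s H J f :
  mono_copy c E k s H f -> subgraph J H -> mono_copy c E k s J f.
Proof.
case/and4P => f_step Hs /forall_inP f_col /forall_inP f_edge /andP[VJ EJ].
apply/and4P; split.
- have -> : [seq x <- s | x \in verts J] =
      [seq x <- [seq x <- s | x \in verts H] | x \in verts J].
    rewrite -filter_predI; apply: eq_filter => x /=.
    by case: (boolP (x \in verts J)) => // /(fintype.subsetP VJ) ->.
  exact: pairwise_filter.
- exact: fintype.subset_trans VJ Hs.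
- by apply/forall_inP => x /(fintype.subsetP VJ); apply: f_col.
- by apply/forall_inP => e /(fintype.subsetP EJ); apply: f_edge.
Qed.

Lemma mono_copy_edges c E E' k s H f : E \subset E' ->
  mono_copy c E k s H f -> mono_copy c E' k s H f.
Proof.
move=> /fintype.subsetP EE' /and4P[f_step Hs f_col /forall_inP f_edge].
by apply/and4P; split=> //; apply/forall_inP => e /f_edge /EE'.
Qed.

Lemma mono_copy_cons c E k u s H f : u \in verts H ->
  mono_copy c E k (u :: s) H f ->
  mono_copy c E k s (delv H u) f /\
  (forall x, x \in verts (delv H u) -> (f x %/ r < f u %/ r)%N).
Proof.
move=> uH /and4P[/= ]; rewrite uH pairwise_cons => /andP[/allP fu f_step].
move=> /fintype.subsetP Hs /forall_inP f_col /forall_inP f_edge.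
have delE x : (x \in verts (delv H u)) = (x \in verts H) && (x != u).
  by rewrite /verts /= !inE.
have dels x : x \in verts (delv H u) -> x \in s.
  by rewrite delE => /andP[/Hs]; rewrite inE => /orP[->|].
split; last first.
  by move=> x xD; apply: fu; rewrite mem_filter dels // andbT; move: xD; rewrite delE => /andP[].
apply/and4P; split.
- have -> : [seq x <- s | x \in verts (delv H u)] =
      [seq x <- [seq x <- s | x \in verts H] | x != u].
    by rewrite -filter_predI; apply: eq_filter => x /=; rewrite delE andbC.
  exact: pairwise_filter.
- exact/fintype.subsetP.
- by apply/forall_inP => x; rewrite delE => /andP[/f_col].
- by apply/forall_inP => e; rewrite /edges /= inE => /andP[/f_edge].
Qed.

(* A vertex numbered [x] would complete [P] in color [k] as its youngest vertex. *)
Definition closes E c (x : nat) (k : 'I_r) P : bool :=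
  (P.1.1 \in verts P.2) &&
  [exists f : {ffun T -> 'I_n}, [&& f P.1.1 == x :> nat,
    mono_copy c E k P.1.2 (delv P.2 P.1.1) f & [forall e in edges P.2, f @: e \in E]]].

(** The successor reserves 0 for positions that close nothing, so any position as bad as a closing
    one closes a pattern too. *)
Definition badness E c x k : nat := \max_(P | closes E c x k P) (rank P).+1.

Definition player : strategy n r := fun i G c =>
  assignment (fun j k => badness (edges G) c (i * r + j) k).

End Board.
End Player.

(** * From badness back to closed patterns *)

Section Badness.
Variables (R : realType) (T : finType) (r : nat) (theta : R) (n : nat).
Variables (E : {set {set 'I_n}}) (c : coloring n r) (x : nat) (k : 'I_r).
Implicit Types (P Q : pattern T).

Lemma closes_badness P : closes E c x k P -> (rank r theta P < badness T theta E c x k)%N.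
Proof. by move=> cP; rewrite /badness (bigD1 P) //= leq_maxl. Qed.

Lemma badness_closes P : (rank r theta P < badness T theta E c x k)%N ->
  exists2 Q : pattern T, closes E c x k Q & (rank r theta P <= rank r theta Q)%N.
Proof.
move=> bP; apply/exists_inP; apply: contraLR bP => /exists_inPn noQ.
rewrite -leqNgt; apply/bigmax_leqP => Q cQ.
by move: (noQ Q cQ); rewrite -ltnNge.
Qed.

End Badness.

(** * Colors are permanent and occur at most once per step *)

Section Play.
Variables (n r : nat) (sigma : strategy n r) (G : graph 'I_n).

Lemma play_colored i v k : play sigma G i v = Some k -> (v %/ r < i)%N.
Proof.
elim: i => [|i IH] /=; rewrite ffunE //.
by case: eqP => [-> //|_ /IH /ltnW].
Qed.

Lemma play_stable i i' (v : 'I_n) : (v %/ r < i)%N -> (i <= i')%N ->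
  play sigma G i' v = play sigma G i v.
Proof.
move=> vi; elim: i' => [|i' IH]; first by rewrite leqn0 => /eqP->.
rewrite leq_eqVlt ltnS => /orP[/eqP-> //|ii']; rewrite -IH //= ffunE ltn_eqF //.
exact: leq_trans vi ii'.
Qed.

Lemma play_step i v k : play sigma G i v = Some k ->
  exists2 j : 'I_r, v = (v %/ r * r + j)%N :> nat
    & k = sigma (v %/ r)%N (visible r G (v %/ r)%N) (play sigma G (v %/ r)%N) j.
Proof.
move=> vk; have vi := play_colored vk.
move: vk; rewrite (@play_stable (v %/ r).+1) // /= ffunE eqxx.
case: insubP => [j _ jE|] //= [<-].
by exists j; rewrite // jE -divn_eq.
Qed.

Lemma play_same_step_inj i u v k : play sigma G i u = Some k ->
  play sigma G i v = Some k -> (u %/ r = v %/ r)%N -> u = v.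
Proof.
move=> /play_step[j uE kj] /play_step[j' vE kj'] uv; apply: ord_inj.
by rewrite uE vE uv; move: kj'; rewrite kj uv => /perm_inj->.
Qed.

End Play.

(** * Modularity of the cost and unions of pairs *)

Section Cost.
Variables (R : realType) (theta : R) (m r : nat).
Implicit Types (S : {set 'I_m}) (E : {set {set 'I_(m * r)}}).

Lemma cost_modular S1 E1 S2 E2 :
  cost theta (S1 :|: S2) (E1 :|: E2) + cost theta (S1 :&: S2) (E1 :&: E2) =
  cost theta S1 E1 + cost theta S2 E2.
Proof.
rewrite /cost addrACA [RHS]addrACA -!opprD -!mulrDr -!natrD.
by rewrite !(cardsUI).
Qed.

Lemma supportedP S E :
  reflect (forall e v, e \in E -> v \in e -> step v \in S) (supported S E).
Proof.
apply: (iffP forall_inP) => [sE e v /sE/forall_inP|sE e eE]; first exact.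
by apply/forall_inP => v; apply: sE.
Qed.

Lemma supportedU S1 E1 S2 E2 : supported S1 E1 -> supported S2 E2 ->
  supported (S1 :|: S2) (E1 :|: E2).
Proof.
move=> /supportedP s1 /supportedP s2; apply/supportedP => e v; rewrite !inE.
by case/orP => [/s1 s ve|/s2 s ve]; rewrite s ?orbT.
Qed.

Lemma supportedI S1 E1 S2 E2 : supported S1 E1 -> supported S2 E2 ->
  supported (S1 :&: S2) (E1 :&: E2).
Proof.
move=> /supportedP s1 /supportedP s2; apply/supportedP => e v; rewrite !inE.
by case/andP => /s1 s /s2 s' ve; rewrite s ?s'.
Qed.

Variables (K : nat) (G : graph 'I_(m * r)).
Hypothesis not_cheap : forall S E, E \subset edges G -> ~~ cheap theta K (S, E).

(** A negative cost would make the pair cheap, unless [S] is empty; then support leaves no edge and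
    the cost is 0. *)
Lemma cost_ge0 S E :
  supported S E -> E \subset edges G -> (#|S| <= K)%N -> 0 <= cost theta S E.
Proof.
move=> sE EG SK; have Ep := fintype.subset_trans EG (edges_pairs G).
have [S0|S0] := eqVneq S finset.set0; last first.
  have := not_cheap S EG.
  by rewrite /cheap /= S0 SK sE Ep /= -ltNge => /ltW.
suff -> : E = finset.set0 by rewrite /cost S0 !cards0 mulr0 subrr.
apply/eqP; rewrite -subset0; apply/fintype.subsetP => e eE; exfalso.
have := fintype.subsetP Ep e eE; rewrite inE => /eqP e2.
have [v ve] : exists v, v \in e by apply/card_gt0P; rewrite e2.
by have /supportedP/(_ e v eE ve) := sE; rewrite S0 inE.
Qed.

(* Overlaps only help: they are not cheap themselves, hence have cost >= 0. *)
Lemma cost_bigcup (I : finType) (S_ : I -> {set 'I_m})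
    (E_ : I -> {set {set 'I_(m * r)}}) :
  (forall i, supported (S_ i) (E_ i)) -> (forall i, E_ i \subset edges G) ->
  (forall i, #|S_ i| <= K)%N ->
  [/\ supported (\bigcup_i S_ i) (\bigcup_i E_ i),
      \bigcup_i E_ i \subset edges G
    & cost theta (\bigcup_i S_ i) (\bigcup_i E_ i) <= \sum_i cost theta (S_ i) (E_ i)].
Proof.
move=> sE EG SK; elim/big_rec3 : _ => [|i S E x _ [IHs IHe IHc]].
  split; [|exact: sub0set|by rewrite /cost !cards0 mulr0 subrr].
  by apply/supportedP => e v; rewrite inE.
split; [exact: supportedU|by rewrite finset.subUset EG|].
apply: le_trans (lerD (lexx _) IHc); rewrite -cost_modular lerDl.
apply: cost_ge0; first exact: supportedI.
  exact: fintype.subset_trans (subsetIl _ _) (EG i).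
exact: leq_trans (subset_leq_card (subsetIl _ _)) (SK i).
Qed.

End Cost.

(** * Histories of monochromatic copies *)

Section History.
Variables (R : realType) (T : finType) (theta delta : R) (L m r : nat).
Variable G : graph 'I_(m * r).

(** Here [r * L.+1] bounds the count of a merger of [r] branches a priori, before the cost
    inequality brings it down to [L]. *)
Definition max_steps : nat := r.+1 ^ (r * L.+1 * #|T|.+1 + #|T|.+1).

Hypothesis delta_gt0 : 0 < delta.
Hypothesis delta_gap : forall P Q : pattern T,
  pthreat r theta P < pthreat r theta Q -> pthreat r theta P + delta <= pthreat r theta Q.
Hypothesis lambda_lt : forall (s : seq T) (H : graph T), (size s <= #|T|)%N ->
  lambda r theta s H < L.+1%:R * delta.
Hypothesis not_cheap : forall (S : {set 'I_m}) (E : {set {set 'I_(m * r)}}),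
  E \subset edges G -> ~~ cheap theta max_steps (S, E).

Local Notation N := #|T|.
Local Notation V := 'I_(m * r).
Local Notation sigma := (@player R T r theta (m * r)).
Local Notation c := (play sigma G).

(* The number [j] counts how often the history used a rival of strictly
   smaller threat; each such use saves [delta], so there are at most [L]. *)
Record history (i h : nat) (b : R) (j : nat) (S : {set 'I_m}) (E : {set {set V}}) : Prop :=
  History {
    history_le : (j <= L)%N;
    history_card : (#|S| <= r.+1 ^ (j * N.+1 + h))%N;
    history_edges : E \subset edges G;
    history_supported : supported S E;
    history_past : forall t, t \in S -> (t < i)%N;
    history_cost : j%:R * delta + cost theta S E <= b }.

(** The history must contain the steps of the copy itself, so that edges to a later vertex are
    supported. *)
Definition has_history (i : nat) : Prop := forall (s : seq T) (H : graph T)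
    (f : {ffun T -> V}) (k : 'I_r), (size s <= N)%N ->
  mono_copy (c i) (edges G) k s H f ->
  exists j S E, history i #|verts H| (lambda r theta s H) j S E /\
    {in verts H, forall x, step (f x) \in S}.

(* The history [(j, S, E)] of a copy that is completed by the vertex number
   [p.1] of step [t] in color [p.2], and the set [D] of completing edges. *)
Record branch (t : nat) (p : 'I_r * 'I_r) (h : nat) (b : R)
    (w : nat * {set 'I_m} * {set {set V}} * {set {set V}}) : Prop := Branch {
  branch_le : (w.1.1.1 <= L.+1)%N;
  branch_card : (#|w.1.1.2| <= r.+1 ^ (w.1.1.1 * N.+1 + h))%N;
  branch_edges : w.1.2 \subset edges G;
  branch_supported : supported w.1.1.2 w.1.2;
  branch_past : forall t', t' \in w.1.1.2 -> (t' < t)%N;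
  branch_star : w.2 \subset edges G;
  branch_starP : forall e, e \in w.2 -> exists x y : V,
    [/\ e = [set x; y], x = (t * r + p.1)%N :> nat, c t y = Some p.2
       & step y \in w.1.1.2];
  branch_cost : w.1.1.1%:R * delta + (cost theta w.1.1.2 w.1.2 - theta * #|w.2|%:R) <= b }.

(** The copy without [u] has a history, and the star of [u] is mapped to exactly [deg J u] edges;
    subtracting [theta] for each turns [lambda] into [threat]. *)
Lemma closing_branch (t : nat) (p : 'I_r * 'I_r) (s : seq T) (J : graph T) (u : T)
    (f : {ffun T -> V}) : has_history t -> (size s <= N)%N -> u \in verts J ->
  f u = (t * r + p.1)%N :> nat -> mono_copy (c t) (edges G) p.2 s (delv J u) f ->
  (forall e, e \in edges J -> f @: e \in edges G) ->
  exists2 w, branch t p #|verts J|.-1 (threat r theta s J u) w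
    & (w.1.1.1 <= L)%N /\ {in verts (delv J u), forall x, step (f x) \in w.1.1.2}.
Proof.
move=> IH sN uJ fu fJ fE; have [j [S [E [hist f_in]]]] := IH _ _ _ _ sN fJ.
have f_inj := mono_copy_inj fJ.
have f_col x : x \in verts (delv J u) -> c t (f x) = Some p.2.
  by case/and4P: fJ => _ _ /forall_inP f_col _ /f_col/eqP.
(* A vertex colored before step [t] differs from [f u], which lies in step [t]. *)
have f_neq x : x \in verts (delv J u) -> f x != f u.
  move=> xJ; apply/negP => /eqP fx; have := play_colored (f_col x xJ).
  by rewrite fx fu divnMDl ?divn_small ?addn0 ?ltnn //; case: p.1 => a /(leq_ltn_trans _)->.
have [le_j card_S EG sE past le_cost] := hist.
pose D := [set f @: e | e : {set T} in [set e in edges J | u \in e]].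
have cardD : #|D| = deg J u.
  rewrite card_in_imset // => e1 e2; rewrite !inE => /andP[e1J ue1] /andP[e2J ue2].
  have [x1 -> x1J] := edge_incident e1J ue1; have [x2 -> x2J] := edge_incident e2J ue2.
  rewrite !imsetU1 !imset_set1 => /setP/(_ (f x1)).
  rewrite !inE eqxx orbT (negPf (f_neq _ x1J)) /= => /esym/eqP/(f_inj _ _ x1J x2J)-> //.
exists (j, S, E, D) => //=; split=> //=.
- exact: ltnW.
- by rewrite -(card_verts_delv uJ).
- by apply/fintype.subsetP => _ /imsetP[e + ->]; rewrite inE => /andP[/fE].
- move=> _ /imsetP[e + ->]; rewrite inE => /andP[eJ ue].
  have [x -> xJ] := edge_incident eJ ue.
  by exists (f u), (f x); rewrite imsetU1 imset_set1 f_col // f_in.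
- by rewrite addrA cardD lerD2r.
Qed.

(** The new step costs 1, overlaps of old histories only help, and the stars are disjoint from each
    other and from the old edges. *)
Lemma glue (i : nat) (t : 'I_m) (pos : 'I_r -> 'I_r * 'I_r) (h : nat) (B : 'I_r -> R)
    (w : 'I_r -> nat * {set 'I_m} * {set {set V}} * {set {set V}}) (x : R) :
  (0 < r)%N -> (t < i)%N -> (h < N)%N -> injective pos ->
  (forall j, branch t (pos j) h (B j) (w j)) ->
  1 + \sum_j B j <= x -> x < L.+1%:R * delta ->
  exists j S E, [/\ history i h.+1 x j S E, t \in S
    & forall j', (w j').1.1.2 \subset S].
Proof.
move=> r0 ti hN pos_inj br le_x x_lt.
pose S := \bigcup_j (w j).1.1.2; pose E := \bigcup_j (w j).1.2; pose D := \bigcup_j (w j).2.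
pose J := (\sum_j (w j).1.1.1)%N.
have wJ j : ((w j).1.1.1 <= J)%N by rewrite /J (bigD1 j) //= leq_addr.
(* A branch counts up to [L] from its history and one more for a strict rival. *)
have JL : (J <= r * L.+1)%N.
  by rewrite -[r in X in (_ <= X)%N]card_ord -sum_nat_const leq_sum // => j _; apply: branch_le (br j).
have cardS_ j : (#|(w j).1.1.2| <= r.+1 ^ (J * N.+1 + h))%N.
  apply: leq_trans (branch_card (br j)) _.
  by rewrite leq_exp2l // leq_add2r leq_mul2r wJ orbT.
have max_le d : (d <= J * N.+1 + N)%N -> (r.+1 ^ d <= max_steps)%N.
  move=> le_d; rewrite leq_exp2l //; apply: leq_trans le_d _.
  by rewrite leq_add // leq_mul2r JL orbT.
have [sE EG costSE] : [/\ supported S E, E \subset edges G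
    & cost theta S E <= \sum_j cost theta (w j).1.1.2 (w j).1.2].
  apply: (cost_bigcup not_cheap) => j; first exact: branch_supported (br j).
    exact: branch_edges (br j).
  apply: leq_trans (cardS_ j) (max_le _ _); rewrite leq_add2l ltnW //.
have tS : t \notin S.
  by apply/bigcupP => -[j _ /(branch_past (br j))]; rewrite ltnn.
have DG : D \subset edges G by apply/bigcupsP => j _; apply: branch_star (br j).
(* The new endpoint of a star edge determines the row and the color of its old endpoint the column,
   so injectivity of [pos] separates the stars. *)
have cardD : #|D| = (\sum_j #|(w j).2|)%N.
  rewrite -sum1_card partition_disjoint_bigcup => [|j j' jj'].
    by apply: eq_bigr => j _; rewrite sum1_card.
  apply/pred0P => e /=; apply: contraNF jj' => /andP[ej ej'].
  have [a [y [eE aE ya _]]] := branch_starP (br j) ej.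
  have [a' [y' [eE' aE' ya' _]]] := branch_starP (br j') ej'.
  have stepy (z : V) k : c t z = Some k -> (z < t * r)%N.
    by move/play_colored; rewrite ltn_divLR.
  have neq (z z' : V) k k' : z = (t * r + k')%N :> nat -> c t z' = Some k -> z != z'.
    move=> zE /stepy z'lt; apply: contraTneq z'lt => <-.
    by rewrite zE -leqNgt leq_addr.
  have aa' : a = a'.
    have : a \in e by rewrite eE !inE eqxx.
    by rewrite eE' !inE (negPf (neq _ _ _ _ aE ya')) orbF => /eqP.
  have yy' : y = y'.
    have : y \in e by rewrite eE !inE eqxx orbT.
    by rewrite eE' !inE eq_sym (negPf (neq _ _ _ _ aE' ya)) => /eqP.
  apply/eqP/pos_inj; move: aE'; rewrite -aa' aE => /addnI/ord_inj p1.
  by move: ya'; rewrite -yy' ya => -[p2]; rewrite [pos j]surjective_pairing p1 p2 -surjective_pairing.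
have stepD e : e \in D -> exists2 a : V, step a = t & a \in e.
  case/bigcupP => j _ /(branch_starP (br j))[a [y [-> aE _ _]]]; exists a; last by rewrite !inE eqxx.
  by apply: ord_inj; rewrite /= aE divnMDl ?divn_small ?addn0.
have disjED : E :&: D = finset.set0.
  apply/setP => e; rewrite !inE; apply/negP => /andP[eE /stepD[a at_ ae]].
  by move: (supportedP _ _ sE e a eE ae); rewrite at_ (negPf tS).
have sED : supported (t |: S) (E :|: D).
  apply/supportedP => e v; rewrite inE => /orP[eE ve|/bigcupP[j _] eD ve].
    by rewrite inE (supportedP _ _ sE e) ?orbT.
  case/(branch_starP (br j)): eD => [a [y [eE aE yc yS]]]; move: ve; rewrite eE !inE => /orP[]/eqP->.
    by apply/orP; left; apply/eqP/ord_inj; rewrite /= aE divnMDl ?divn_small ?addn0.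
  by apply/orP; right; apply/bigcupP; exists j.
have card_tS : (#|t |: S| <= r.+1 ^ (J * N.+1 + h.+1))%N.
  rewrite cardsU1 tS add1n addnS expnS.
  have le_S : (#|S| <= r * r.+1 ^ (J * N.+1 + h))%N.
    rewrite -[X in (_ <= X * _)%N]card_ord -sum_nat_const.
    apply: leq_trans (_ : \sum_j #|(w j).1.1.2| <= _)%N; last by apply: leq_sum.
    rewrite /S; elim/big_rec2: _ => [|j a b _ IHa]; first by rewrite cards0.
    by rewrite (leq_trans (leq_card_setU _ _).1) // leq_add2l.
  by rewrite mulSn -add1n leq_add // expn_gt0.
have cost_tS : cost theta (t |: S) (E :|: D) = 1 + (cost theta S E - theta * #|D|%:R).
  rewrite /cost cardsU1 tS cardsU disjED cards0 subn0 !natrD mulrDr opprD !addrA.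
  by [].
have JE : (J%:R * delta + cost theta (t |: S) (E :|: D) <= x).
  apply: le_trans le_x; rewrite cost_tS addrCA lerD2l.
  apply: le_trans (_ : \sum_j ((w j).1.1.1%:R * delta +
     (cost theta (w j).1.1.2 (w j).1.2 - theta * #|(w j).2|%:R)) <= _); last first.
    by apply: ler_sum => j _; apply: branch_cost (br j).
  rewrite big_split /= -mulr_suml -natr_sum lerD2l.
  rewrite (big_split _ _ _ (fun j => cost theta (w j).1.1.2 (w j).1.2)) /= lerD //.
  by rewrite sumrN -mulr_sumr -natr_sum -cardD.
have EDG : E :|: D \subset edges G by rewrite finset.subUset EG DG.
have cost0 : 0 <= cost theta (t |: S) (E :|: D).
  apply: (cost_ge0 not_cheap) => //; apply: leq_trans card_tS (max_le _ _).
  by rewrite leq_add2l.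
(* As the cost is nonnegative, [J%:R * delta] is at most [x], hence below [L.+1%:R * delta]. *)
have leJ : (J <= L)%N.
  rewrite -ltnS -(ltr_nat R) -(ltr_pM2r delta_gt0); apply: le_lt_trans x_lt.
  by apply: le_trans JE; rewrite lerDl.
exists J, (t |: S), (E :|: D); split; last first.
- by move=> j; apply: fintype.subset_trans (subsetUr _ _); apply: (bigcup_sup j).
- by rewrite !inE eqxx.
split=> // t'; rewrite !inE => /orP[/eqP-> //|/bigcupP[j _ /(branch_past (br j))]].
by move/ltn_trans; apply.
Qed.

(** The default value is the term of [H], so the minimum is attained by an admissible [J]. *)
Lemma bigmin_threat_le (s : seq T) (H : graph T) (u : T) : u \in verts H ->
  exists J, [/\ subgraph J H, u \in verts J & threat r theta s J u <=
    \big[Num.min/lambda r theta s (delv H u) - theta * (deg H u)%:R]_(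
        J : graph T | subgraph J H && (u \in verts J))
      (lambda r theta s (delv J u) - theta * (deg J u)%:R)].
Proof.
move=> uH; elim/big_ind : _ => [|x y [J [JH uJ Jx]] [J' [JH' uJ' Jy]]|J /andP[JH uJ]].
- by exists H; rewrite subgraph_refl uH.
- by rewrite minElt; case: ifP => _; [exists J|exists J'].
- by exists J; rewrite JH uJ.
Qed.

(** Strong induction on [i]: if the youngest vertex of [H] was placed in step [t], the rest of [H]
    and the copies threatened at the rival positions existed before [t] and have histories, which
    [glue] merges. *)
Lemma player_has_history (i : nat) : has_history i.
Proof.
elim/ltn_ind: i => i IH; elim=> [|u s IHs] H f k sN fH.
  have H0 : verts H = finset.set0.
    case/and4P: fH => _ /fintype.subsetP Hs _ _; apply/setP => x; rewrite inE.
    by apply/negP => /Hs.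
  exists 0%N, finset.set0, finset.set0; split; last by move=> x; rewrite H0 inE.
  split=> //=; rewrite ?cards0 ?sub0set ?expn_gt0 //.
  - by apply/supportedP => e v; rewrite inE.
  - by move=> t; rewrite inE.
  - by rewrite mul0r /cost !cards0 mulr0 subrr addr0.
have [uH|uH] := boolP (u \in verts H); last first.
  rewrite /= (negPf uH); apply: (IHs _ f k (ltnW sN)).
  case/and4P: fH; rewrite /= (negPf uH) => f_step /fintype.subsetP Hs f_col f_edge.
  apply/and4P; split=> //; apply/fintype.subsetP => x xH.
  by have := Hs x xH; rewrite inE => /orP[/eqP xu|//]; rewrite -xu xH in uH.
have [fD f_lt] := mono_copy_cons uH fH.
have f_col x : x \in verts H -> c i (f x) = Some k.
  by case/and4P: fH => _ _ /forall_inP col _ /col /eqP.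
have f_edge e : e \in edges H -> f @: e \in edges G.
  by case/and4P: fH => _ _ _ /forall_inP; apply.
have [j fu kE] := play_step (f_col u uH); have ti := play_colored (f_col u uH).
have r0 : (0 < r)%N := leq_ltn_trans (leq0n j) (ltn_ord j).
set t := (f u %/ r)%N in fu kE ti f_lt *.
set Gt := edges (visible r G t); set ct := c t in kE.
have GtG : Gt \subset edges G by apply/fintype.subsetP => e; rewrite inE => /andP[].
(* All other vertices of [H] are older than [u], so the player saw the whole copy in step [t]. *)
have f_vis e : e \in edges H -> f @: e \in Gt.
  move=> eH; rewrite inE f_edge //=; apply/fintype.subsetP => _ /imsetP[x xe ->].
  rewrite inE -ltn_divLR // ltnS.
  have [->//|xu] := eqVneq x u.
  have /forall_inP/(_ e eH)/andP[_ /fintype.subsetP eV] := graph_valP H.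
  by rewrite ltnW // f_lt // /verts /= !inE xu eV.
have copyJ J : subgraph J H -> u \in verts J -> mono_copy ct Gt k s (delv J u) f.
  move=> JH uJ; case/and4P: fD => f_step /fintype.subsetP Hs _ _.
  have fDt : mono_copy ct Gt k s (delv H u) f.
    apply/and4P; split=> //; first exact/fintype.subsetP.
      apply/forall_inP => x xD; rewrite -(play_stable _ _ (f_lt x xD) (ltnW ti)).
      by rewrite f_col //; move: xD; rewrite /verts /= !inE => /andP[].
    by apply/forall_inP => e; rewrite /edges /= inE => /andP[/f_vis].
  apply: mono_copy_sub fDt _; case/andP: JH => VJ EJ; apply/andP; split.
    by apply: finset.setSI.
  apply/fintype.subsetP => e; rewrite !inE => /andP[/(fintype.subsetP EJ) -> /=].
  by [].
have [J0 [J0H uJ0 J0min]] := bigmin_threat_le s uH.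
have sN' : (size s <= N)%N := ltnW sN.
pose P0 : pattern T := (u, Bseq sN', J0).
pose b (j k : 'I_r) := badness T theta Gt ct (t * r + j) k.
have kb : k = assignment b j := kE.
have b0 : (rank r theta P0 < b j (assignment b j))%N.
  apply: closes_badness; rewrite -kb /closes /= uJ0; apply/existsP; exists f.
  rewrite fu eqxx copyJ //=; apply/forall_inP => e eJ0; apply: f_vis.
  by case/andP: J0H => _ /fintype.subsetP; apply.
have IHt := IH t ti.
(* The index [j] keeps the copy of [H]; every other position is at least as bad as one closing [P0],
   hence closes some [Q] ranked no lower. *)
have rivals j' : exists w, branch t (rival b j j') #|verts H|.-1
    (if j' == j then threat r theta s H u else threat r theta s J0 u) w /\
    (j' = j -> {in verts (delv H u), forall x, step (f x) \in w.1.1.2}).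
  case: eqP => [->|j'j].
    rewrite rival_id -kb.
    have [] := @closing_branch t (j, k) s H u f IHt sN' uH fu _ f_edge.
      exact: mono_copy_edges GtG (copyJ H (subgraph_refl H) uH).
    by move=> w bw [_ f_in]; exists w; split.
  have [Q cQ rQ] := badness_closes (leq_trans b0 (leq_rival b j j')).
  case/andP: cQ => uQ /existsP[g /and3P[/eqP gu gQ /forall_inP g_edge]].
  have [] := @closing_branch t (rival b j j') Q.1.2 Q.2 Q.1.1 g IHt _ uQ gu.
  - exact: size_bseq.
  - exact: mono_copy_edges GtG gQ.
  - by move=> e /g_edge; apply/fintype.subsetP.
  move=> w [le_j card_S EG sE past starG starP le_cost] [w_le _].
  (* A strict rival saves [delta] and raises the count, whose extra [N.+1] in the exponent absorbs a
     larger [Q]. At equal threat [Q] is no larger than [J0], so the exponent of [H] suffices. *)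
  case: (leq_rank rQ) => [ltQ|[eqQ leQ]].
    exists (w.1.1.1.+1, w.1.1.2, w.1.2, w.2); split=> //; split=> //=.
      apply: leq_trans card_S _; rewrite leq_exp2l // mulSn -addnA addnCA leq_add2l.
      apply: leq_trans (leq_pred _) (leq_trans (max_card _) _).
      by rewrite (leq_trans (leqnSn _)) // leq_addr.
    rewrite -natr1 mulrDl mul1r addrAC; apply: le_trans (delta_gap ltQ).
    by rewrite lerD2r.
  exists w; split=> //; split=> //.
    apply: leq_trans card_S _; rewrite leq_exp2l // leq_add2l.
    rewrite -!subn1 leq_sub2r //; apply: leq_trans leQ (subset_leq_card _).
    by case/andP: J0H.
  by rewrite -[threat _ _ s J0 u]/(pthreat r theta P0) -eqQ.
have [w w_br] := fin_all_exists rivals.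
have [] := @glue i (Ordinal (step_subproof (f u))) (rival b j) #|verts H|.-1
  (fun j' => if j' == j then threat r theta s H u else threat r theta s J0 u) w
  (lambda r theta (u :: s) H) r0 ti _ (@rival_inj r b j) (fun j' => (w_br j').1).
- by rewrite prednK ?max_card // card_gt0; apply/set0Pn; exists u.
(* This is the recursion of [lambda]: index [j] gives the term of [H], the other [r - 1] indices at
   most the minimum each. *)
- rewrite /= uH (bigD1 j) //= eqxx.
  rewrite (eq_bigr (fun=> threat r theta s J0 u)) => [|j' /negPf->//].
  rewrite sumr_const -[X in _ + (_ + X)]mulr_natl cardC1 card_ord.
  rewrite addrA lerD2l -subn1 natrB // ler_wpM2l // subr_ge0 ler1n //.
- exact: lambda_lt.
move=> J [S [E [hist tS subS]]]; exists J, S, E; split.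
  by move: hist; rewrite prednK // card_gt0; apply/set0Pn; exists u.
move=> x xH; have [->|xu] := eqVneq x u.
  by rewrite (_ : step (f u) = Ordinal (step_subproof (f u))).
apply: (fintype.subsetP (subS j)); apply: (w_br j).2 => //.
by rewrite /verts /= !inE xu andbT.
Qed.

Lemma player_wins (F : graph T) : (0 < r)%N -> edges F != finset.set0 ->
  Lambda r theta F <= 0 -> wins F sigma G.
Proof.
move=> r0 F_edge Lambda0; apply/negP => /existsP[H' /and3P[H'G]].
case/existsP => f /and3P[f_inj /eqP VH' /eqP EH'] /existsP[k /forall_inP f_col].
rewrite mulnK // in f_col.
have {}f_col x : x \in verts F -> c m (f x) = Some k.
  by move=> xF; apply/eqP/f_col; rewrite VH' imset_f.
have {}f_inj : {in verts F &, injective f}.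
  move=> x y xF yF /eqP; move: f_inj => /forall_inP/(_ x xF)/forall_inP/(_ y yF).
  by move=> /implyP fxy /fxy /eqP.
have f_edge e : e \in edges F -> f @: e \in edges G.
  by move=> eF; case/andP: H'G => _ /fintype.subsetP; apply; rewrite EH' imset_f.
(* Sorts the youngest vertex first; the order is strict because the copy has one color. *)
pose older : rel T := fun x y => (f y %/ r <= f x %/ r)%N.
pose s := sort older (enum (verts F)).
have sF : perm_eq s (enum (verts F)) by rewrite perm_sort.
have mem_s x : (x \in s) = (x \in verts F) by rewrite (perm_mem sF) mem_enum.
have fF : mono_copy (c m) (edges G) k s F f.
  apply/and4P; split.
  - have -> : [seq x <- s | x \in verts F] = s.
      by apply/all_filterP/allP => x; rewrite mem_s.
    have : pairwise [rel x y | older x y && (x != y)] s.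
      rewrite pairwise_relI -uniq_pairwise (perm_uniq sF) enum_uniq andbT.
      rewrite -sorted_pairwise; last by move=> x y z xy yz; apply: leq_trans yz xy.
      by apply: sort_sorted => x y; apply: leq_total.
    apply: (sub_in_pairwise (P := mem (verts F))); last by apply/allP => x; rewrite mem_s.
    move=> x y xF yF /andP[xy nxy]; rewrite ltn_neqAle [(_ <= _)%N]xy andbT.
    apply: contra nxy => /eqP fxy; apply/eqP/f_inj => //.
    by apply: (play_same_step_inj (f_col x xF) (f_col y yF)).
  - by apply/fintype.subsetP => x; rewrite mem_s.
  - by apply/forall_inP => x /f_col ->.
  - by apply/forall_inP => e /f_edge.
have F0 : verts F != finset.set0.
  case/set0Pn: F_edge => e eF; have /forall_inP/(_ e eF)/andP[/eqP e2 /fintype.subsetP eV] := graph_valP F.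
  have [x xe] : exists x, x \in e by apply/card_gt0P; rewrite e2.
  by apply/set0Pn; exists x; apply: eV.
have [H [HF H0 le_H]] : exists H, [/\ subgraph H F, verts H != finset.set0
    & lambda r theta s H <= min_lambda r theta F s].
  rewrite /min_lambda; elim/big_ind : _ => [|x y [J [JF J0 Jx]] [J' [JF' J0' Jy]]|J /andP[JF J0]].
  - by exists F; rewrite subgraph_refl.
  - by rewrite minElt; case: ifP => _; [exists J|exists J'].
  - by exists J.
(* The ordering [s] is one of those over which [Lambda] maximizes. *)
have le0 : lambda r theta s H <= 0.
  apply: le_trans le_H (le_trans _ Lambda0).
  by apply: bigmax_sup_seq (lexx _); rewrite ?mem_permutations.
have sN : (size s <= N)%N by rewrite (perm_size sF) -cardE max_card.
have [j [S [E [[jL card_S EG sE _ le_cost] in_S]]]] :=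
  player_has_history sN (mono_copy_sub fF HF).
have /negP := not_cheap S EG; apply; rewrite /cheap /= sE.
case/set0Pn: H0 => x xH; apply/and5P; split=> //.
- by apply/set0Pn; exists (step (f x)); apply: in_S.
- apply: leq_trans card_S _; rewrite leq_exp2l // leq_add //.
    rewrite leq_mul2r orbC; apply/orP; left.
    by apply: leq_trans jL (leq_trans (leqnSn _) (leq_pmull _ r0)).
  exact: leq_trans (max_card _) (leqnSn _).
- exact: fintype.subset_trans EG (edges_pairs G).
- apply: le_trans le0; apply: le_trans le_cost; rewrite lerDr.
  by rewrite mulr_ge0 // ltW.
Qed.

End History.

(** * Uniform constants from finiteness *)

Lemma finite_gap (R : realType) (I : finType) (F : I -> R) :
  exists2 delta, 0 < delta & forall i j, F i < F j -> F i + delta <= F j.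
Proof.
exists (\big[Num.min/1]_(ij : I * I | F ij.1 < F ij.2) (F ij.2 - F ij.1)).
  by apply/bigmin_gtP; split=> // ij; rewrite subr_gt0.
move=> i j ltij; rewrite addrC -lerBrDr.
exact: (bigmin_le_cond _ (j := (i, j))).
Qed.

Lemma lambda_bounded (R : realType) (T : finType) (r : nat) (theta delta : R) : 0 < delta ->
  exists L : nat, forall (s : seq T) (H : graph T), (size s <= #|T|)%N ->
    lambda r theta s H < L.+1%:R * delta.
Proof.
move=> delta0.
pose B := \big[Num.max/0]_(sH : #|T|.-bseq T * graph T) lambda r theta sH.1 sH.2.
have B0 : 0 <= B by apply: bigmax_ge_id.
exists (Num.bound (B / delta)) => s H sN.
apply: (@le_lt_trans _ _ B); first exact: (le_bigmax _ _ (Bseq sN, H)).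
rewrite -ltr_pdivrMr // -natr1.
by rewrite (lt_le_trans (archi_boundP _)) ?divr_ge0 ?(ltW delta0) // lerDl.
Qed.

(* Convergence of the winning probability *)
From mathcomp Require Import all_classical all_reals all_analysis.
Import numFieldNormedType.Exports.
Local Open Scope classical_set_scope.
Local Open Scope ring_scope.

Theorem theorem7 (R : realType) (T : finType) (F : graph T) (r : nat)
    (theta : R) (p : nat -> R)
    (F_nonempty : edges F != finset.set0)
    (r_ge2 : (2 <= r)%N)
    (theta_02 : 0 <= theta <= 2)
    (theta_root : Lambda r theta F = 0)
    (p_01 : forall n : nat, 0 <= p n <= 1)
    (p_small : p =o_\oo (fun n : nat => (n%:R : R) `^ (- theta))) :
  exists sigma : forall n : nat, strategy n r,
    (fun m : nat => gnp_pr (p (m * r)%N) (wins F (sigma (m * r)%N))) @ \oo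
      --> (1 : R).
Proof.
exists (@player R T r theta).
have r0 : (0 < r)%N := ltnW r_ge2.
have [delta delta0 gap] := finite_gap (@pthreat R T r theta).
have [L lambda_lt] := lambda_bounded T r theta delta0.
pose K := max_steps T L r; pose C : R := (K.+1 * 2 ^ 2 ^ (K * r))%:R.
have C0 : 0 < C by rewrite ltr0n muln_gt0 expn_gt0.
(* A lost game has a cheap pair in its graph, so the union bound runs over cheap pairs. *)
have bound m : let pm := p (m * r)%N in
    1 - \sum_(W : {set 'I_m} * {set {set 'I_(m * r)}} | cheap theta K W) pm ^+ #|W.2|
      <= gnp_pr pm (wins F (@player R T r theta (m * r))) <= 1.
  apply: gnp_pr_union => // [W /and5P[]//|G _ lost].
  have [W WG cW] : exists2 W : {set 'I_m} * {set {set 'I_(m * r)}},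
      W.2 \subset edges G & cheap theta K W.
    apply/exists_inP; apply: contraNT lost => /exists_inPn not_cheap.
    apply: (player_wins delta0 gap lambda_lt) => // [S E EG|].
      exact: (not_cheap (S, E) EG).
    by rewrite theta_root.
  by exists W.
apply/cvgrPdist_le => e e0.
(* The cap 1 is required by [sum_cheap_le], and [e / C] brings its bound [eps * C] down to [e]. *)
pose eps := Num.min 1 (e / C).
have eps01 : 0 <= eps <= 1.
  by rewrite ge_min lexx le_min ler01 divr_ge0 // ltW.
have eps0 : 0 < eps by rewrite lt_min ltr01 divr_gt0.
have /eqoP/(_ eps eps0) [n0 _ p_le] := p_small.
exists n0 => // m /= n0m.
have {bound} /andP[lower upper] := bound m.
rewrite ger0_norm ?subr_ge0 // lerBlDr -lerBlDl.
apply: le_trans lower; rewrite lerD2l lerN2.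
have /andP[p0 _] := p_01 (m * r)%N.
have pm : p (m * r)%N <= eps * (m * r)%:R `^ (- theta).
  have := p_le (m * r)%N (leq_trans n0m (leq_pmulr _ r0)).
  by rewrite /= !ger0_norm // powR_ge0.
apply: le_trans (sum_cheap_le K r0 p0 eps01 pm) _.
by rewrite -ler_pdivlMr // ge_min lexx orbT.
Qed.
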